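(* There exist absolute constants $c, C_1, C_2>0$ such that the following holds. Let $n\ge 1$, $d\in\{1,\dots,n\}$, and let $\Gamma$ be a uniformly random element of $\mathcal{D}_{n,d}$. Put $p=d/n$ and $\hat d=\min(d,n-d)$. For $\eta\ge 0$ let $\mathcal{G}^{\mathrm{co}}(\eta)$ be the event that for every pair of distinct vertices $i_1,i_2\in[n]$, $$\left|\overset{\rightarrow}{\mathrm{co}}_\Gamma(i_1,i_2)-p^2n\right|\le \eta\, p(1-p)n .$$ Then: (1) (Uniform control on codegrees) For any $\eta\ge0$, the event $\mathcal{G}^{\mathrm{co}}(\eta)$ holds except with probability $$O\!\left(n^2\hat d^2\exp\!\left(-c\,\eta\min\{\hat d,\ \eta n\}\right)\right).$$ In particular, for any $K_1>0$ there exists $K_2>0$ such that $\mathcal{G}^{\mathrm{co}}(\eta)$ holds with probability $1-O(n^{-K_1})$ whenever $$\eta\ge K_2\max\left\{\frac{\log n}{\min(d,n-d)},\ \sqrt{\frac{\log n}{n}}\right\}.$$ (2) (Concentration of edge counts) For any $A,B\subset[n]$ and any $\tau\ge0$, $$\mathbb{P}\Big(\{e_\Gamma(A,B)-\mu\ge \tau\hat\mu\}\wedge \mathcal{G}^{\mathrm{co}}(\eta)\Big)\le \exp\!\left(-\frac{\tau^2\hat\mu}{C_1+C_2\tau}\right)\quad\text{provided } \eta\le\min\left(\tfrac14,\tfrac{\tau}{8}\right),$$ and $$\mathbb{P}\Big(\{e_\Gamma(A,B)-\mu\le -\tau\hat\mu\}\wedge \mathcal{G}^{\mathrm{co}}(\eta)\Big)\le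 \exp\!\left(-\frac{\tau^2\hat\mu}{C_1}\right)\quad\text{provided } \eta\le\tfrac{\tau}{4}.$$ In particular, if $\eta\le\min(\frac14,\frac\tau8)$, then $$\mathbb{P}\Big(\{\mathrm{disc}_\Gamma(A,B)\ge \tau\hat\mu(A,B)\}\wedge \mathcal{G}^{\mathrm{co}}(\eta)\Big)\le 2\exp\!\left(-\frac{\tau^2}{C_1+C_2\tau}\hat\mu(A,B)\right).$$
   Context: $\mathcal{D}_{n,d}$ is the set of $d$-regular directed graphs on the vertex set $[n]=\{1,\dots,n\}$ (self-loops allowed, no multiple edges): the edge set $E\subset[n]^2$ is such that every vertex has exactly $d$ out-neighbors and $d$ in-neighbors. Write $i\to j$ for $(i,j)\in E$. For distinct $i_1,i_2$, $\overset{\rightarrow}{\mathrm{co}}_\Gamma(i_1,i_2)=|\{j\in[n]: i_1\to j \text{ and } i_2\to j\}|$ (number of common out-neighbors). For $A,B\subset[n]$: $e_\Gamma(A,B)=|E\cap(A\times B)|$, $\mu=\mu(A,B)=p|A||B|$, $\hat\mu=\hat\mu(A,B)=p\min\big(|A||B|,(n-|A|)(n-|B|)\big)$, and $\mathrm{disc}_\Gamma(A,B)=|e_\Gamma(A,B)-\mu(A,B)|$. Asymptotic $O(\cdot)$ is as $n\to\infty$ with absolute implied constants. *)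

(* Defs.v *)
From mathcomp Require Import all_boot all_order all_algebra.
From mathcomp Require Import reals sequences exp.
Set Implicit Arguments.
Unset Strict Implicit.
Unset Printing Implicit Defensive.
Import Order.TTheory GRing.Theory Num.Theory.
Local Open Scope ring_scope.

(* A directed graph on the vertex set 'I_n is identified with its edge set
   E : {set 'I_n * 'I_n}: loops are allowed, multiple edges are not. *)

Definition out_nbrs (n : nat) (E : {set 'I_n * 'I_n}) (i : 'I_n) : {set 'I_n} :=
  [set j | (i, j) \in E].

Definition in_nbrs (n : nat) (E : {set 'I_n * 'I_n}) (j : 'I_n) : {set 'I_n} :=
  [set i | (i, j) \in E].

Definition regular_digraphs (n d : nat) : {set {set 'I_n * 'I_n}} :=
  [set E | [forall i, (#|out_nbrs E i| == d) && (#|in_nbrs E i| == d)]].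

Definition co_out (n : nat) (E : {set 'I_n * 'I_n}) (i1 i2 : 'I_n) : nat :=
  #|out_nbrs E i1 :&: out_nbrs E i2|.

Definition edge_count (n : nat) (E : {set 'I_n * 'I_n}) (A B : {set 'I_n}) : nat :=
  #|E :&: setX A B|.

Definition density (R : realType) (n d : nat) : R := d%:R / n%:R.

Definition dhat (n d : nat) : nat := minn d (n - d).

Definition mu (R : realType) (n d : nat) (A B : {set 'I_n}) : R :=
  density R n d * #|A|%:R * #|B|%:R.

(* The subtractions on nat are exact, since #|A| and #|B| are at most n. *)
Definition muhat (R : realType) (n d : nat) (A B : {set 'I_n}) : R :=
  density R n d * (minn (#|A| * #|B|) ((n - #|A|) * (n - #|B|)))%:R.

Definition disc (R : realType) (n d : nat) (E : {set 'I_n * 'I_n})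
    (A B : {set 'I_n}) : R :=
  `|(edge_count E A B)%:R - mu R d A B|.

Definition good_codegrees (R : realType) (n d : nat) (eta : R)
    (E : {set 'I_n * 'I_n}) : bool :=
  let p := density R n d in
  [forall i1, forall i2, (i1 != i2) ==>
    (`|(co_out E i1 i2)%:R - p ^+ 2 * n%:R| <= eta * (p * (1 - p) * n%:R))].

(* Probability of the event ev for a uniformly random element of D, where D is
   nonempty; regular_digraphs n d is nonempty for d <= n (circulant digraphs). *)
Definition uniform_pr (R : realType) (T : finType) (D : {set T}) (ev : pred T) : R :=
  #|[set x in D | ev x]|%:R / #|D|%:R.

Definition digraph_pr (R : realType) (n d : nat) (ev : pred {set 'I_n * 'I_n}) : R :=
  uniform_pr R (regular_digraphs n d) ev.

(* Main.v *)
Require Import Defs.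
From mathcomp Require Import all_boot all_order all_algebra.
From mathcomp Require Import perm ring lra zify.
From mathcomp Require Import reals topology normedtype derive sequences exp realfun.
Set Implicit Arguments.
Unset Strict Implicit.
Unset Printing Implicit Defensive.
Import Order.TTheory GRing.Theory Num.Theory.
Import numFieldNormedType.Exports.
Local Open Scope ring_scope.

(* Both families of estimates follow from one moment generating function bound.
   Let A, A' be disjoint sets of rows and S a set of columns which may depend on
   the rows outside A and A', such that the number T of edges from A and A' to S
   is constant; let X be the number of edges from A to S.  For r in A, s in A',
   j in S, k not in S with r -> j, s -> k, r -/> k, s -/> j, switch to r -> k,
   s -> j, with weight 1 / #|N(r) \ N(s)|, which the switching preserves.  Row
   regularity makes the weighted number Phi of switchings lowering X minus that
   of switchings raising X exactly (|A| + |A'|)(X - nu), where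
   nu = |A| T / (|A| + |A'|), and Phi <= (|A| + |A'|) X.  Reversibility gives
     z (|A| + |A'|) E[(X - nu) z^X] = (z - 1) E[Phi z^X],
   so M(z) = E z^X satisfies M' <= nu M for z >= 1 and M' >= nu M for z <= 1,
   hence M(z) <= exp(nu (z - 1)): X is at least as concentrated as a Poisson
   variable of mean nu.
   For edge counts, A' is the complement of A, S = B and nu = mu (or the same
   with A and B replaced by their complements, which leaves e - mu unchanged).
   For the codegree of i1, i2, A = {i2}, S = N(i1) and A' is the set of other
   vertices, giving nu = d (d - 1) / (n - 1); complementing the graph reduces
   to d <= n / 2. *)

(** * Exponential moments *)

(** Squaring [1 - x / 2 <= expR (- x / 2)] gives [(1 - x / 2) ^+ 2 * expR x <= 1], and a polynomial
    inequality finishes. There is no lower bound on [x], so lower tails may use any negative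
    parameter. *)
Lemma expR_le_quadratic (R : realType) (x : R) :
  x <= 1 -> expR x <= 1 + x + 2 * x ^+ 2.
Proof.
move=> x1.
have h : expR (- x / 2) >= 1 - x / 2.
  by apply: le_trans (expR_ge1Dx _); lra.
have pos : 0 < expR (x / 2) by exact: expR_gt0.
have inv : expR (- x / 2) * expR (x / 2) = 1.
  by rewrite -expRD (_ : _ + _ = 0) ?expR0 //; lra.
have sq : expR x = expR (x / 2) ^+ 2.
  by rewrite expr2 -expRD; congr expR; lra.
have u1 : (1 - x / 2) * expR (x / 2) <= 1 by rewrite -[leRHS]inv ler_pM2r ?pos.
have u2 : (1 - x / 2) ^+ 2 * expR x <= 1.
  by rewrite sq -exprMn; apply: exprn_ile1 => //; apply: mulr_ge0; lra.
have key : 1 <= (1 + x + 2 * x ^+ 2) * (1 - x / 2) ^+ 2.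
  rewrite -subr_ge0 [leRHS](_ : _ = x ^+ 2 * (1 - x) * (5 - 2 * x) / 4); last by field.
  apply: divr_ge0 => //; apply: mulr_ge0; last lra.
  by apply: mulr_ge0; [exact: sqr_ge0|lra].
have p2 : 0 < (1 - x / 2) ^+ 2 by rewrite exprn_gt0 //; lra.
by rewrite -(ler_pM2l p2); apply: le_trans u2 _; rewrite mulrC.
Qed.

(* Gronwall for [p' <= nu p] beyond 1 and [p' >= nu p] before 1: the quotient
   of [p] by [expR (nu * z)] is maximal at 1. *)
Lemma horner_le_expR (R : realType) (p : {poly R}) (nu : R) :
  (forall z, 1 <= z -> p^`().[z] <= nu * p.[z]) ->
  (forall z, 0 < z <= 1 -> nu * p.[z] <= p^`().[z]) ->
  forall z, 0 < z -> p.[z] <= p.[1] * expR (nu * (z - 1)).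
Proof.
move=> up lo z z0.
pose f := fun x : R => p.[x] * expR (- nu * x).
have df x : is_derive x (1 : R) f ((p^`().[x] - nu * p.[x]) * expR (- nu * x)).
  have d1 : is_derive x (1 : R) (fun y : R => expR (- nu * y)) (- nu * expR (- nu * x)).
    apply: is_derive_eq; rewrite /GRing.scale /=; ring.
  by apply: is_derive_eq; rewrite /GRing.scale /=; ring.
have drv x : derivable f x 1 by case: (df x).
have drvE x : derive1 f x = (p^`().[x] - nu * p.[x]) * expR (- nu * x).
  by rewrite derive1E; case: (df x).
suff : f z <= f 1.
  rewrite /f mulr1 => h; rewrite -(ler_pM2r (expR_gt0 (- nu * z))).
  apply: le_trans h _; rewrite -mulrA -expRD le_eqVlt; apply/orP; left.
  by apply/eqP; congr (_ * expR _); ring.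
have [z1|/ltW z1] := leP 1 z.
  apply: (@ler0_derive1_nincr _ f 1 z) => //;
    last exact: derivable_within_continuous.
  move=> x; rewrite in_itv /= => /andP[x1 _].
  by rewrite drvE mulr_le0_ge0 ?expR_ge0 // subr_le0 up // ltW.
apply: (@ger0_derive1_ndecr _ f z 1) => //;
  last exact: derivable_within_continuous.
move=> x; rewrite in_itv /= => /andP[x1 x2].
by rewrite drvE mulr_ge0 ?expR_ge0 // subr_ge0 lo // (ltW x2) (lt_trans z0).
Qed.

(** Markov's inequality for [expR (theta * X)], with [nu * (expR theta - 1) - theta * nu <= 2 * nu *
    theta ^+ 2]. Keeping [theta] on both sides of the event lets its sign select the tail: upper if
    positive, lower if negative. *)
Lemma uniform_pr_chernoff (R : realType) (T : finType) (D : {set T})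
    (X : T -> nat) (nu t theta : R) :
  (forall z : R, 0 < z -> \sum_(x in D) z ^+ X x <= #|D|%:R * expR (nu * (z - 1))) ->
  0 <= nu -> theta <= 1 ->
  uniform_pr R D (fun x => theta * t <= theta * ((X x)%:R - nu))
    <= expR (2 * nu * theta ^+ 2 - theta * t).
Proof.
move=> mgf nu0 th1; rewrite /uniform_pr.
have [->|D0] := eqVneq #|D| 0%N; first by rewrite invr0 mulr0 expR_ge0.
rewrite ler_pdivrMr ?ltr0n ?lt0n //.
rewrite -(ler_pM2r (expR_gt0 (theta * t + theta * nu))).
apply: (@le_trans _ _ (\sum_(x in D) expR theta ^+ X x)).
  rewrite -sum1_card natr_sum mulr_suml.
  rewrite [leRHS](bigID (fun x => theta * t <= theta * ((X x)%:R - nu))) /=.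
  rewrite -[leLHS]addr0 lerD ?sumr_ge0 // => [|x _]; last first.
    by rewrite exprn_ge0 ?expR_ge0.
  under eq_bigl => x do rewrite inE.
  apply: ler_sum => x /andP[_ hx]; rewrite mul1r -expRM_natr ler_expR.
  by rewrite mulrBr in hx; lra.
apply: le_trans (mgf _ (expR_gt0 _)) _.
rewrite [leRHS]mulrAC -expRD [leRHS]mulrC ler_pM2l ?ltr0n ?lt0n // ler_expR.
have := ler_wpM2l nu0 (expR_le_quadratic th1); lra.
Qed.

(** * Weighted switchings *)

(** Pulling rows [r] and [s] back along a transposition of columns gives an involution on all
    graphs, so that sums can be reindexed by it without side conditions. *)
Definition switch (n : nat) (r s : 'I_n) (jk : 'I_n * 'I_n)
    (E : {set 'I_n * 'I_n}) : {set 'I_n * 'I_n} :=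
  [set e | (if (e.1 == r) || (e.1 == s) then (e.1, tperm jk.1 jk.2 e.2) else e)
           \in E].

(** These are the column pairs whose exchange moves an edge of [r] out of [S] and an edge of [s]
    into [S]. The product form makes their number a product of two cardinalities. *)
Definition switchable (n : nat) (S : {set 'I_n}) (r s : 'I_n)
    (E : {set 'I_n * 'I_n}) : {set 'I_n * 'I_n} :=
  setX ((out_nbrs E r :\: out_nbrs E s) :&: S)
       ((out_nbrs E s :\: out_nbrs E r) :\: S).

Lemma switchK (n : nat) (r s : 'I_n) jk : involutive (switch r s jk).
Proof.
move=> E; apply/setP=> -[i c]; rewrite !inE /=.
by case ic: ((i == r) || (i == s)); rewrite /= ic /= ?tpermK.
Qed.

Lemma out_nbrs_switch (n : nat) (r s : 'I_n) jk E i :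
  out_nbrs (switch r s jk E) i =
  if (i == r) || (i == s) then tperm jk.1 jk.2 @^-1: out_nbrs E i
  else out_nbrs E i.
Proof. by apply/setP=> c; case: ifP => ic; rewrite !inE /= ic. Qed.

Lemma card_tperm_preim (T : finType) (j k : T) (A : {set T}) :
  #|tperm j k @^-1: A| = #|A|.
Proof.
rewrite on_card_preimset //; apply: onW_bij.
by exists (tperm j k) => x; rewrite tpermK.
Qed.

Lemma switchableP (n : nat) (S : {set 'I_n}) (r s : 'I_n) (E : {set 'I_n * 'I_n}) jk :
  reflect [/\ (r, jk.1) \in E, (s, jk.1) \notin E, (r, jk.2) \notin E,
              (s, jk.2) \in E & (jk.1 \in S) && (jk.2 \notin S)]
          (jk \in switchable S r s E).
Proof.
case: jk => j k; rewrite /switchable !inE /=.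
by apply: (iffP idP) => [/andP[/andP[/andP[-> ->] ->] /and3P[-> -> ->]]|
  [-> -> -> -> /andP[-> ->]]].
Qed.

(** Reversibility: on a switchable pair of columns the switching interchanges the patterns of rows
    [r] and [s], so the same pair undoes it with the rows swapped. *)
Lemma switchable_switch (n : nat) (S : {set 'I_n}) (r s : 'I_n)
    (E : {set 'I_n * 'I_n}) jk :
  (jk \in switchable S s r (switch r s jk E)) = (jk \in switchable S r s E).
Proof.
case: jk => j k; rewrite /switchable !inE /= !eqxx !orbT /= !tpermL !tpermR.
by case: ((r, j) \in E); case: ((s, j) \in E); case: ((r, k) \in E);
  case: ((s, k) \in E); case: (j \in S); case: (k \in S).
Qed.

(* The submatrix on rows [r, s] and columns [j, k] is the identity, so swapping
   its columns amounts to swapping its rows. *)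
Lemma in_nbrs_switch (n : nat) (S : {set 'I_n}) (r s : 'I_n)
    (E : {set 'I_n * 'I_n}) jk c :
  jk \in switchable S r s E ->
  in_nbrs (switch r s jk E) c =
  if (c == jk.1) || (c == jk.2) then tperm r s @^-1: in_nbrs E c
  else in_nbrs E c.
Proof.
move=> /switchableP[rj sj rk sk _]; apply/setP=> i.
rewrite [LHS]inE /switch inE /=.
case: ifP => [/orP[/eqP->|/eqP->]|/norP[/eqP ir /eqP is_]].
- case: ifP => [/orP[/eqP->|/eqP->]|/norP[/eqP cj /eqP ck]]; rewrite !inE.
  + by rewrite tpermL tpermL (negbTE rk) (negbTE sj).
  + by rewrite tpermR tpermL rj sk.
  + by rewrite tpermD //; apply/eqP => // /esym.
- case: ifP => [/orP[/eqP->|/eqP->]|/norP[/eqP cj /eqP ck]]; rewrite !inE.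
  + by rewrite tpermL tpermR rj sk.
  + by rewrite tpermR tpermR (negbTE rk) (negbTE sj).
  + by rewrite tpermD //; apply/eqP => // /esym.
- by case: ifP; rewrite !inE // tpermD //; apply/eqP => /esym.
Qed.

Lemma switch_regular (n d : nat) (S : {set 'I_n}) (r s : 'I_n)
    (E : {set 'I_n * 'I_n}) jk :
  jk \in switchable S r s E ->
  (switch r s jk E \in regular_digraphs n d) = (E \in regular_digraphs n d).
Proof.
move=> sw; rewrite !inE; apply: eq_forallb => i.
rewrite out_nbrs_switch (in_nbrs_switch _ sw).
by do 2![case: ifP => _]; rewrite ?card_tperm_preim.
Qed.

(** Double counting: for each fixed [jk], the involution [switch r s jk] matches the regular graphs
    admitting [jk] in direction [s], [r] with those admitting it in direction [r], [s]. *)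
Lemma sum_switchable (R : realType) (n d : nat) (r s : 'I_n)
    (S : {set 'I_n * 'I_n} -> {set 'I_n}) (F G : {set 'I_n * 'I_n} -> R) :
  (forall E jk, S (switch r s jk E) = S E) ->
  (forall E jk, E \in regular_digraphs n d -> jk \in switchable (S E) r s E ->
     F (switch r s jk E) = G E) ->
  \sum_(E in regular_digraphs n d) #|switchable (S E) s r E|%:R * F E =
  \sum_(E in regular_digraphs n d) #|switchable (S E) r s E|%:R * G E.
Proof.
move=> Sinv FG.
have expand (H : {set 'I_n * 'I_n} -> R) (u v : 'I_n) :
    \sum_(E in regular_digraphs n d) #|switchable (S E) u v E|%:R * H E =
    \sum_(jk : 'I_n * 'I_n) \sum_(E | (E \in regular_digraphs n d)
       && (jk \in switchable (S E) u v E)) H E.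
  rewrite (exchange_big_dep (fun E => E \in regular_digraphs n d)) /=;
    last by move=> i j _ /andP[].
  by apply: eq_bigr => E ED; under eq_bigl => jk do rewrite ED /=;
    rewrite sumr_const mulr_natl.
rewrite !expand; apply: eq_bigr => jk _.
rewrite (reindex_inj (inv_inj (switchK r s jk))) /=.
apply: eq_big => [E|E /andP[]]; rewrite Sinv switchable_switch.
  by apply: andb_id2r => /switch_regular ->.
by move=> + sw; rewrite (switch_regular _ sw) => ED; apply: FG.
Qed.

(** Let m be the common size of the two differences of the rows, and a, b the sizes of their parts
    inside [S]. Then a(m - b) - b(m - a) = m(a - b), so the weight 1/m makes the difference
    linear. *)
Lemma card_switchableB (R : realType) (n : nat) (S : {set 'I_n}) (r s : 'I_n)
    (E : {set 'I_n * 'I_n}) :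
  #|out_nbrs E r| = #|out_nbrs E s| ->
  (#|switchable S r s E|%:R - #|switchable S s r E|%:R)
    / #|out_nbrs E r :\: out_nbrs E s|%:R
  = #|out_nbrs E r :&: S|%:R - #|out_nbrs E s :&: S|%:R :> R.
Proof.
rewrite /switchable !cardsX; move: (out_nbrs E r) (out_nbrs E s) => M N MN.
have h1 := cardsID N (M :&: S); have h2 := cardsID M (N :&: S).
rewrite -setIDAC in h1; rewrite -setIDAC in h2.
have e : M :&: S :&: N = N :&: S :&: M by rewrite -setIA setIC [S :&: N]setIC.
rewrite e in h1.
have h3 := cardsID S (M :\: N); have h4 := cardsID S (N :\: M).
have h5 := cardsID N M; have h6 := cardsID M N; rewrite setIC in h6.
have MN' : #|N :\: M| = #|M :\: N| by lia.
(* Here the inverse is 0 by convention; the rows coincide, so the right side vanishes too. *)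
have [z|nz] := eqVneq #|M :\: N| 0%N.
  by rewrite z invr0 mulr0; apply/esym/eqP; rewrite subr_eq0 eqr_nat; lia.
rewrite -h1 -h2 !natrD !natrM.
rewrite (_ : #|(N :\: M) :\: S|%:R = #|M :\: N|%:R - #|(N :\: M) :&: S|%:R :> R);
  last by rewrite -MN' -h4 natrD; ring.
rewrite (_ : #|(M :\: N) :\: S|%:R = #|M :\: N|%:R - #|(M :\: N) :&: S|%:R :> R);
  last by rewrite -h3 natrD; ring.
have : #|M :\: N|%:R != 0 :> R by rewrite pnatr_eq0.
by move=> nzR; field.
Qed.

(** The factor counting columns outside [S] is at most the common size of the two differences, which
    the weight cancels. *)
Lemma card_switchable_le (R : realType) (n : nat) (S : {set 'I_n}) (r s : 'I_n)
    (E : {set 'I_n * 'I_n}) :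
  #|out_nbrs E r| = #|out_nbrs E s| ->
  #|switchable S r s E|%:R / #|out_nbrs E r :\: out_nbrs E s|%:R
  <= #|out_nbrs E r :&: S|%:R :> R.
Proof.
rewrite /switchable !cardsX; move: (out_nbrs E r) (out_nbrs E s) => M N MN.
have [z|nz] := eqVneq #|M :\: N| 0%N; first by rewrite z invr0 mulr0.
rewrite ler_pdivrMr ?ltr0n ?lt0n // -natrM ler_nat leq_mul //.
  by apply/subset_leq_card/setSI/subsetDl.
apply: leq_trans (subset_leq_card (subsetDl _ _)) _.
have := cardsID N M; have := cardsID M N; rewrite setIC => h1 h2.
by rewrite -(leq_add2l #|M :&: N|) h1 h2 MN.
Qed.

Lemma sum_out_nbrs_switch (n : nat) (A S : {set 'I_n}) (r s : 'I_n)
    (E : {set 'I_n * 'I_n}) jk :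
  r \in A -> s \notin A -> jk \in switchable S r s E ->
  \sum_(i in A) #|out_nbrs E i :&: S|
  = (\sum_(i in A) #|out_nbrs (switch r s jk E) i :&: S|).+1.
Proof.
move=> rA sA /switchableP[rj _ rk _ /andP[jS kS]].
rewrite (bigD1 r) // [in RHS](bigD1 r) //= -addSn; congr addn; last first.
  apply: eq_bigr => i /andP[iA ir]; rewrite out_nbrs_switch (negbTE ir) /=.
  by case: eqP iA => // ->; rewrite (negbTE sA).
rewrite out_nbrs_switch eqxx /= (cardsD1 jk.1) !inE rj jS add1n; congr _.+1.
apply: eq_card => c; rewrite !inE /=.
case: tpermP => [->|->|/eqP/negbTE->] //; first by rewrite eqxx (negbTE rk).
by rewrite (negbTE kS) !andbF.
Qed.

Lemma regular_out_card (n d : nat) (E : {set 'I_n * 'I_n}) i :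
  E \in regular_digraphs n d -> #|out_nbrs E i| = d.
Proof. by rewrite inE => /forallP/(_ i)/andP[/eqP]. Qed.

Lemma regular_in_card (n d : nat) (E : {set 'I_n * 'I_n}) j :
  E \in regular_digraphs n d -> #|in_nbrs E j| = d.
Proof. by rewrite inE => /forallP/(_ j)/andP[_ /eqP]. Qed.

(** Letting [S] vary with the graph allows it to be the neighbourhood of a vertex. Since it depends
    only on rows outside [A] and [A'], switchings between these sets leave it fixed. *)
Lemma regular_digraphs_mgf (R : realType) (n d T : nat) (A A' : {set 'I_n})
    (S : {set 'I_n * 'I_n} -> {set 'I_n}) :
  [disjoint A & A'] -> (0 < #|A| + #|A'|)%N ->
  (forall E E', (forall i, i \notin A :|: A' -> out_nbrs E i = out_nbrs E' i) ->
     S E = S E') ->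
  (forall E, E \in regular_digraphs n d ->
     \sum_(i in A) #|out_nbrs E i :&: S E| +
     \sum_(i in A') #|out_nbrs E i :&: S E| = T)%N ->
  forall z : R, 0 < z ->
  \sum_(E in regular_digraphs n d) z ^+ (\sum_(i in A) #|out_nbrs E i :&: S E|)%N
  <= #|regular_digraphs n d|%:R *
     expR (#|A|%:R * T%:R / (#|A| + #|A'|)%:R * (z - 1)).
Proof.
move=> dAA' K0 Sloc Stot.
set D := regular_digraphs n d; set nu : R := _ / _.
pose x E i := #|out_nbrs E i :&: S E|.
pose X E := (\sum_(i in A) x E i)%N.
have KR : 0 < (#|A| + #|A'|)%:R :> R by rewrite ltr0n.
have notA s : s \in A' -> s \notin A by move/(disjointFl dAA') => ->.
have Sinv r s E jk : r \in A -> s \in A' -> S (switch r s jk E) = S E.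
  move=> rA sA; apply: Sloc => i; rewrite inE negb_or out_nbrs_switch => /andP[iA iA'].
  by case: eqP iA => [->|_]; rewrite ?rA //; case: eqP iA' => [->|_]; rewrite ?sA.
pose w (E : {set 'I_n * 'I_n}) (r s : 'I_n) : R := (#|out_nbrs E r :\: out_nbrs E s|%:R)^-1.
pose phi (E : {set 'I_n * 'I_n}) (r s : 'I_n) : R := #|switchable (S E) r s E|%:R * w E r s.
pose psi (E : {set 'I_n * 'I_n}) (r s : 'I_n) : R := #|switchable (S E) s r E|%:R * w E r s.
(* The factor [z] compensates for the one edge by which a switching from [r] to [s] lowers [X]. *)
have balance r s z : r \in A -> s \in A' ->
    z * (\sum_(E in D) psi E r s * z ^+ X E) = \sum_(E in D) phi E r s * z ^+ X E.
  move=> rA sA.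
  have := @sum_switchable R n d r s S (fun E => w E r s * z ^+ (X E).+1)
    (fun E => w E r s * z ^+ X E).
  rewrite -/D => h; rewrite mulr_sumr.
  transitivity (\sum_(E in D) #|switchable (S E) s r E|%:R * (w E r s * z ^+ (X E).+1)).
    by apply: eq_bigr => E _; rewrite /psi exprS; ring.
  rewrite h => [|E jk|E jk ED sw]; last 2 first.
  - exact: Sinv.
  - rewrite [in RHS]/X /x (sum_out_nbrs_switch rA (notA _ sA) sw) /X /x Sinv //.
    congr (_^-1 * _); rewrite !out_nbrs_switch !eqxx orbT /=.
    by rewrite -preimsetD card_tperm_preim.
  by apply: eq_bigr => E _; rewrite /phi mulrA.
(* Summing x_r - x_s over both sets gives |A'| X - |A| (T - X), where [T - X] counts the edges from
   [A']. *)
have drift E : E \in D ->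
    \sum_(r in A) \sum_(s in A') (phi E r s - psi E r s)
    = (#|A| + #|A'|)%:R * ((X E)%:R - nu).
  move=> ED.
  transitivity (\sum_(r in A) \sum_(s in A') ((x E r)%:R - (x E s)%:R : R)).
    apply: eq_bigr => r _; apply: eq_bigr => s _.
    by rewrite /phi /psi -mulrBl card_switchableB // !(regular_out_card _ ED).
  under eq_bigr => r _ do rewrite sumrB sumr_const -[_ *+ _]mulr_natl.
  rewrite sumrB -mulr_sumr sumr_const -[_ *+ _]mulr_natl -!natr_sum -/(X E).
  have := Stot _ ED; rewrite -/(X E) => /(congr1 (fun m => m%:R : R)).
  rewrite natrD => TE; rewrite mulrBr /nu mulrCA divff ?lt0r_neq0 // mulr1 -TE.
  by rewrite natrD; ring.
have bound E : E \in D -> \sum_(r in A) \sum_(s in A') phi E r s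
    <= (#|A| + #|A'|)%:R * (X E)%:R.
  move=> ED; apply: (@le_trans _ _ (\sum_(r in A) \sum_(s in A') ((x E r)%:R : R))).
    apply: ler_sum => r _; apply: ler_sum => s _.
    by rewrite /phi /w card_switchable_le // !(regular_out_card _ ED).
  under eq_bigr => r _ do rewrite sumr_const -[_ *+ _]mulr_natl.
  by rewrite -mulr_sumr -natr_sum ler_wpM2r // ler_nat leq_addl.
pose Phi z := \sum_(E in D) \sum_(r in A) \sum_(s in A') phi E r s * z ^+ X E.
(* If Psi denotes the sum of the [psi] terms, then z Psi = Phi by [balance], hence z (Phi - Psi) =
   (z - 1) Phi. *)
have mgf_identity z : z * \sum_(E in D) (#|A| + #|A'|)%:R * ((X E)%:R - nu) * z ^+ X E
    = (z - 1) * Phi z.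
  have -> : \sum_(E in D) (#|A| + #|A'|)%:R * ((X E)%:R - nu) * z ^+ X E =
      \sum_(E in D) \sum_(r in A) \sum_(s in A') (phi E r s - psi E r s) * z ^+ X E.
    apply: eq_bigr => E ED; rewrite -drift // mulr_suml.
    by apply: eq_bigr => r _; rewrite mulr_suml.
  rewrite /Phi exchange_big [in RHS]exchange_big /= !mulr_sumr.
  apply: eq_bigr => r rA; rewrite exchange_big [in RHS]exchange_big /= !mulr_sumr.
  apply: eq_bigr => s sA.
  under eq_bigr => E _ do rewrite mulrBl.
  by rewrite sumrB mulrBr balance // mulrBl mul1r.
have Phi_le z : 0 < z -> Phi z <= \sum_(E in D) (#|A| + #|A'|)%:R * (X E)%:R * z ^+ X E.
  move=> z0; apply: ler_sum => E ED.
  apply: le_trans (ler_wpM2r (exprn_ge0 (X E) (ltW z0)) (bound E ED)).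
  by rewrite mulr_suml; apply: ler_sum => r _; rewrite mulr_suml.
pose p : {poly R} := \sum_(E in D) 'X^(X E).
have pE z : p.[z] = \sum_(E in D) z ^+ X E.
  by rewrite /p horner_sum; apply: eq_bigr => E _; rewrite hornerXn.
have dpE z : z * p^`().[z] = \sum_(E in D) (X E)%:R * z ^+ X E.
  rewrite /p linear_sum /= horner_sum mulr_sumr; apply: eq_bigr => E _.
  rewrite /= derivXn hornerMn hornerXn; case: (X E) => [|m]; 
    first by rewrite mulr0n !mul0r mulr0.
  by rewrite -mulr_natl mulrCA -exprS.
(* Multiplying [Phi_le] by [z - 1] keeps or reverses it according to the sign; the terms in [z ^+ 2]
   times the derivative then cancel against the identity. *)
have main z : 0 < z -> (z - 1 >= 0 -> z * p^`().[z] <= z * (nu * p.[z])) *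
    (z - 1 <= 0 -> z * (nu * p.[z]) <= z * p^`().[z]).
  move=> z0; have := mgf_identity z; have := Phi_le z z0.
  have -> : \sum_(E in D) (#|A| + #|A'|)%:R * (X E)%:R * z ^+ X E =
      (#|A| + #|A'|)%:R * (z * p^`().[z]).
    by rewrite dpE mulr_sumr; apply: eq_bigr => E _; rewrite mulrA.
  have -> : \sum_(E in D) (#|A| + #|A'|)%:R * ((X E)%:R - nu) * z ^+ X E =
      (#|A| + #|A'|)%:R * (z * p^`().[z] - nu * p.[z]).
    rewrite dpE pE mulr_sumr -sumrB mulr_sumr; apply: eq_bigr => E _; ring.
  move=> le eq; split=> z1; rewrite -(ler_pM2l KR).
    have := ler_wpM2l z1 le; rewrite -eq; lra.
  have := ler_wnM2l z1 le; rewrite -eq; lra.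
move=> z z0; rewrite -pE.
have -> : #|D|%:R = p.[1] :> R.
  by rewrite pE -sum1_card natr_sum; apply: eq_bigr => E _; rewrite expr1n.
apply: horner_le_expR => // y hy.
  have y0 : 0 < y by apply: lt_le_trans hy.
  by rewrite -(ler_pM2l y0) main // subr_ge0.
by case/andP: hy => y0 y1; rewrite -(ler_pM2l y0) main // subr_le0.
Qed.

(** * Edge counts *)

Lemma edge_countE (n : nat) (E : {set 'I_n * 'I_n}) (A B : {set 'I_n}) :
  edge_count E A B = (\sum_(i in A) #|out_nbrs E i :&: B|)%N.
Proof.
rewrite /edge_count -sum1_card.
under [RHS]eq_bigr => i _ do rewrite -sum1_card.
rewrite pair_big_dep /=; apply: eq_bigl => -[i j].
by rewrite !inE /= andbA [in RHS]andbA; congr (_ && _); rewrite andbC.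
Qed.

Lemma edge_countE_in (n : nat) (E : {set 'I_n * 'I_n}) (A B : {set 'I_n}) :
  edge_count E A B = (\sum_(j in B) #|in_nbrs E j :&: A|)%N.
Proof.
rewrite /edge_count -sum1_card.
under [RHS]eq_bigr => i _ do rewrite -sum1_card.
rewrite (exchange_big_dep (mem A)) /=; last by move=> j i _; rewrite inE => /andP[].
rewrite pair_big_dep /=; apply: eq_bigl => -[i j]; rewrite !inE /=.
by case: (i \in A); case: (j \in B); rewrite ?andbT ?andbF.
Qed.

Lemma edge_count_rows (n : nat) (E : {set 'I_n * 'I_n}) (A B : {set 'I_n}) :
  (edge_count E A B + edge_count E (~: A) B)%N = edge_count E setT B.
Proof.
rewrite !edge_countE_in -big_split /=; apply: eq_bigr => j _.
by rewrite setIT -(cardsID A (in_nbrs E j)) setDE.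
Qed.

Lemma edge_count_setT (n d : nat) (E : {set 'I_n * 'I_n}) (B : {set 'I_n}) :
  E \in regular_digraphs n d -> edge_count E setT B = (d * #|B|)%N.
Proof.
move=> ED; rewrite edge_countE_in mulnC -sum_nat_const.
by apply: eq_bigr => j _; rewrite setIT (regular_in_card _ ED).
Qed.

Lemma edge_count_setC (n d : nat) (E : {set 'I_n * 'I_n}) (A B : {set 'I_n}) :
  E \in regular_digraphs n d ->
  (edge_count E (~: A) (~: B) + d * #|A| + d * #|B| = d * n + edge_count E A B)%N.
Proof.
move=> ED; have h1 := edge_count_rows E A B; have h2 := edge_count_rows E A (~: B).
rewrite (edge_count_setT _ ED) in h1; rewrite (edge_count_setT _ ED) in h2.
have h3 : (edge_count E A B + edge_count E A (~: B) = d * #|A|)%N.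
  rewrite !edge_countE -big_split /= mulnC -sum_nat_const; apply: eq_bigr => i _.
  by rewrite -setDE cardsID (regular_out_card _ ED).
have := cardsC B; rewrite card_ord => hB; nia.
Qed.

Lemma natr_cardsC (R : realType) (n : nat) (A : {set 'I_n}) :
  #|~: A|%:R = n%:R - #|A|%:R :> R.
Proof.
have := cardsC A; rewrite card_ord => /(congr1 (fun m => m%:R : R)).
by rewrite natrD; lra.
Qed.

(** By regularity, complementing both sets changes the edge count and its mean by the same
    deterministic amount. This is what brings the minimum into [muhat]. *)
Lemma edge_deviation_setC (R : realType) (n d : nat) (E : {set 'I_n * 'I_n})
    (A B : {set 'I_n}) :
  (0 < n)%N -> E \in regular_digraphs n d ->
  (edge_count E (~: A) (~: B))%:R - mu R d (~: A) (~: B)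
  = (edge_count E A B)%:R - mu R d A B.
Proof.
move=> n0 ED; have := edge_count_setC A B ED => /(congr1 (fun m => m%:R : R)).
rewrite !natrD !natrM /mu /density.
rewrite !natr_cardsC.
have nR : n%:R != 0 :> R by rewrite pnatr_eq0 -lt0n.
move=> h; apply/eqP; rewrite -subr_eq0.
rewrite [X in X - _](_ : _ = (edge_count E A B)%:R + (edge_count E (~: A) (~: B))%:R
   + d%:R * #|A|%:R + d%:R * #|B|%:R - (edge_count E A B)%:R - d%:R * n%:R
   - d%:R / n%:R * #|A|%:R * #|B|%:R); last by field.
by rewrite subr_eq0; apply/eqP; lra.
Qed.

Lemma uniform_pr_le (R : realType) (T : finType) (D : {set T}) (P Q : pred T) :
  (forall x, x \in D -> P x -> Q x) -> uniform_pr R D P <= uniform_pr R D Q.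
Proof.
move=> PQ; rewrite /uniform_pr ler_wpM2r ?invr_ge0 ?ler0n // ler_nat subset_leq_card //.
by apply/subsetP => x; rewrite !inE => /andP[xD Px]; rewrite xD PQ.
Qed.

Lemma uniform_pr_exists (R : realType) (T I : finType) (D : {set T})
    (P : I -> pred T) :
  uniform_pr R D (fun x => [exists i, P i x]) <= \sum_i uniform_pr R D (P i).
Proof.
rewrite /uniform_pr -mulr_suml ler_wpM2r ?invr_ge0 ?ler0n // -natr_sum ler_nat.
rewrite (_ : [set x in D | _] = \bigcup_i [set x in D | P i x]).
  elim/big_rec2: _ => [|i m U _ IH]; first by rewrite cards0.
  by rewrite (leq_trans (leq_card_setU _ _)) // leq_add2l.
apply/setP => x; rewrite inE; apply/andP/bigcupP => [[xD /existsP[i Pix]]|[i _]].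
  by exists i; rewrite // inE xD.
by rewrite inE => /andP[xD Pix]; split=> //; apply/existsP; exists i.
Qed.

Lemma uniform_prU (R : realType) (T : finType) (D : {set T}) (P Q : pred T) :
  uniform_pr R D (fun x => P x || Q x) <= uniform_pr R D P + uniform_pr R D Q.
Proof.
rewrite /uniform_pr -mulrDl ler_wpM2r ?invr_ge0 ?ler0n // -natrD ler_nat.
apply: leq_trans (leq_card_setU _ _).
by apply/subset_leq_card/subsetP => x; rewrite !inE -andb_orr.
Qed.

Lemma edge_count_tail (R : realType) (n d : nat) (A B : {set 'I_n}) (theta t : R) :
  (0 < n)%N -> theta <= 1 ->
  digraph_pr R d (fun E => theta * t <= theta * ((edge_count E A B)%:R - mu R d A B))
  <= expR (2 * muhat R d A B * theta ^+ 2 - theta * t).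
Proof.
move=> n0 th1.
have mu_tail (A' B' : {set 'I_n}) :
    digraph_pr R d (fun E => theta * t <= theta * ((edge_count E A' B')%:R - mu R d A' B'))
    <= expR (2 * mu R d A' B' * theta ^+ 2 - theta * t).
  apply: uniform_pr_chernoff => //.
  - move=> z z0; under eq_bigr => E _ do rewrite edge_countE.
    have KA : (#|A'| + #|~: A'| = n)%N by rewrite cardsC card_ord.
    have := @regular_digraphs_mgf R n d (d * #|B'|) A' (~: A') (fun=> B') _ _ _ _ z z0.
    rewrite KA /= (_ : _ / n%:R = mu R d A' B'); last first.
      by rewrite /mu /density natrM; ring.
    apply=> //; first by rewrite -setI_eq0 setICr.
    by move=> E ED; rewrite -!edge_countE edge_count_rows (edge_count_setT _ ED).
  - by rewrite /mu /density !mulr_ge0 ?invr_ge0 ?ler0n.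
have muE (A' B' : {set 'I_n}) : density R n d * (#|A'| * #|B'|)%:R = mu R d A' B'.
  by rewrite /mu natrM mulrA.
have cE (U : {set 'I_n}) : (n - #|U|)%N = #|~: U|.
  by have := cardsC U; rewrite card_ord; lia.
(* [muhat] is the mean for whichever of [A], [B] or their complements gives the smaller product; the
   tail bound is applied to that pair. *)
rewrite /muhat !cE; case: leqP => _; rewrite muE; first exact: mu_tail.
apply: le_trans (mu_tail (~: A) (~: B)).
by apply: uniform_pr_le => E ED; rewrite edge_deviation_setC.
Qed.

(** * Codegrees *)

(** The exact expected codegree of two distinct vertices: the neighbourhood of the first receives
    [d * (d - 1)] edges from the other [n - 1] rows, equally distributed in expectation. *)
Definition codegree_mean (R : realType) (n d : nat) : R :=
  d%:R * (d%:R - 1) / (n%:R - 1).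

Lemma co_out_tail (R : realType) (n d : nat) (i1 i2 : 'I_n) (theta t : R) :
  (0 < d)%N -> i1 != i2 -> theta <= 1 ->
  digraph_pr R d
    (fun E => theta * t <= theta * ((co_out E i1 i2)%:R - codegree_mean R n d))
  <= expR (2 * codegree_mean R n d * theta ^+ 2 - theta * t).
Proof.
move=> d0 i12 th1; rewrite /codegree_mean; set nu := _ / _.
have n2 : (1 < n)%N.
  by move: i12 (ltn_ord i1) (ltn_ord i2); rewrite -val_eqE /=; lia.
have KE : (#|[set i2]| + #|~: [set i1; i2]| = n.-1)%N.
  by have := cardsC [set i1; i2]; rewrite card_ord cards1 cards2 i12; lia.
have nuE : #|[set i2]|%:R * (d * d.-1)%:R / (#|[set i2]| + #|~: [set i1; i2]|)%:R = nu.
  by rewrite KE cards1 mul1r natrM -!subn1 !natrB // ltnW.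
apply: uniform_pr_chernoff => //; last first.
  have d1 : 0 <= d%:R - 1 :> R by rewrite subr_ge0 ler1n.
  have n1 : 0 <= n%:R - 1 :> R by rewrite subr_ge0 ler1n ltnW.
  by rewrite /nu !mulr_ge0 ?invr_ge0 ?ler0n.
move=> z z0.
rewrite (eq_bigr (fun E => z ^+ (\sum_(i in [set i2]) #|out_nbrs E i :&: out_nbrs E i1|)%N));
  last by move=> E _; rewrite big_set1 setIC.
rewrite -nuE; apply: regular_digraphs_mgf => //.
- by rewrite disjoints1 !inE eqxx orbT.
- by rewrite cards1.
- by move=> E E'; apply; rewrite !inE eqxx (negbTE i12).
(* Of the [d * d] edges into the neighbourhood of [i1], row [i1] itself supplies [d]. *)
- move=> E ED; rewrite big_set1; have i21 : i2 != i1 by rewrite eq_sym.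
  have := edge_count_setT (out_nbrs E i1) ED; rewrite edge_countE.
  rewrite (bigD1 i1) ?inE //= (bigD1 i2) ?inE ?i21 //=.
  rewrite setIid (regular_out_card _ ED) => h.
  rewrite -subn1 mulnBr muln1 -h addKn; congr addn.
  by apply: eq_bigl => i; rewrite !inE negb_or.
Qed.

(** The quadratic is minimal at [eta * n / (16 * d)], with value [- (eta ^+ 2 * n / 128)]. When this
    exceeds 1, [theta = 1] is taken and the linear term dominates. *)
Lemma chernoff_parameter (R : realType) (n d eta : R) :
  0 < n -> 0 < d -> 0 <= eta ->
  exists2 theta : R, 0 <= theta <= 1 &
    2 * (d ^+ 2 / n) * theta ^+ 2 - theta * (eta * d / 4)
      <= - (1 / 128 * eta * Num.min d (eta * n)).
Proof.
move=> n0 d0 eta0; have eta1 : 0 <= 1 / 128 * eta by rewrite mulr_ge0 // divr_ge0.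
have [le|lt] := leP (eta * n) (16 * d).
  exists (eta * n / (16 * d)).
    rewrite divr_ge0 ?mulr_ge0 //=; try exact: ltW.
    by rewrite ler_pdivrMr ?mul1r // mulr_gt0.
  rewrite [leLHS](_ : _ = - (1 / 128 * eta * (eta * n))).
    by rewrite lerN2 ler_wpM2l // ge_min lexx orbT.
  by field; rewrite !gt_eqF.
exists 1; rewrite ?ler01 ?lexx //.
have h : d ^+ 2 / n <= eta * d / 16.
  by rewrite ler_pdivrMr //; have := ler_wpM2r (ltW d0) (ltW lt); lra.
have : 1 / 128 * eta * Num.min d (eta * n) <= 1 / 128 * eta * d.
  by rewrite ler_wpM2l // ge_min lexx.
have : 0 <= eta * d by rewrite mulr_ge0 // ltW.
by rewrite expr1n; lra.
Qed.

(** The centre [p ^+ 2 * n] exceeds the mean by the allowed deviation [t] divided by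
    [eta * (n - 1)], hence by at most [t / 2]. A deviation of [t / 2] about the mean remains, and
    [1 - p >= 1 / 2] makes it at least [eta * d / 4]. *)
Lemma co_out_deviation (R : realType) (n d : nat) (i1 i2 : 'I_n) (eta : R) :
  (0 < d)%N -> (2 * d <= n)%N -> i1 != i2 -> 0 <= eta -> 2 <= eta * (n%:R - 1) ->
  digraph_pr R d
    (fun E => ~~ (`|(co_out E i1 i2)%:R - density R n d ^+ 2 * n%:R|
                  <= eta * (density R n d * (1 - density R n d) * n%:R)))
  <= 2 * expR (- (1 / 128 * eta * Num.min d%:R (eta * n%:R))).
Proof.
move=> d0 dn i12 eta0 etan; set p := density R n d.
have dR : 0 < d%:R :> R by rewrite ltr0n.
have dnR : 2 * d%:R <= n%:R :> R by rewrite -natrM ler_nat.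
have d1 : 1 <= d%:R :> R by rewrite ler1n.
have nR : 0 < n%:R :> R by lra.
have n1 : 0 < n%:R - 1 :> R by lra.
have [theta /andP[th0 th1] hth] := chernoff_parameter nR dR eta0.
set nu : R := codegree_mean R n d.
set t := eta * (p * (1 - p) * n%:R).
have tE : t = eta * (d%:R * (1 - d%:R / n%:R)).
  by rewrite /t /p /density; field; rewrite gt_eqF.
have p_half : d%:R / n%:R <= 1 / 2 :> R by rewrite ler_pdivrMr //; lra.
have mE : p ^+ 2 * n%:R = d%:R ^+ 2 / n%:R.
  by rewrite /p /density; field; rewrite gt_eqF.
have gap : d%:R ^+ 2 / n%:R - nu = d%:R * (1 - d%:R / n%:R) / (n%:R - 1).
  by rewrite /nu /codegree_mean; field; rewrite !gt_eqF.
have q0 : 0 <= d%:R * (1 - d%:R / n%:R) :> R by rewrite mulr_ge0 ?ltW //; lra.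
have gap0 : 0 <= d%:R ^+ 2 / n%:R - nu by rewrite gap divr_ge0 // ltW.
have gapt : d%:R ^+ 2 / n%:R - nu <= t / 2.
  rewrite gap ler_pdivrMr // tE; have := ler_wpM2r q0 etan; lra.
have th_le : 2 * nu * theta ^+ 2 - theta * (t / 2)
    <= - (1 / 128 * eta * Num.min d%:R (eta * n%:R)).
  apply: le_trans hth; apply: lerB.
    by rewrite ler_wpM2r ?sqr_ge0 // ler_wpM2l // -subr_ge0.
  apply: ler_wpM2l => //; rewrite tE -!mulrA ler_wpM2l //.
  have := ler_wpM2l (ltW dR) p_half; lra.
apply: (@le_trans _ _ (digraph_pr R d (fun E =>
    (theta * (t / 2) <= theta * ((co_out E i1 i2)%:R - nu))
    || (- theta * - (t / 2) <= - theta * ((co_out E i1 i2)%:R - nu))))).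
  apply: uniform_pr_le => E _; rewrite -ltNge mE => dev.
  apply/orP; move: dev.
  case: (ger0P ((co_out E i1 i2)%:R - d%:R ^+ 2 / n%:R)) => sgn dev; [left|right].
    by rewrite ler_wpM2l //; lra.
  by rewrite !mulNr mulrN opprK -mulrN ler_wpM2l //; lra.
apply: le_trans (uniform_prU _ _ _ _) _.
rewrite mulr_natl mulr2n lerD //.
  by apply: le_trans (co_out_tail _ d0 i12 th1) _; rewrite ler_expR.
have th1' : - theta <= 1 by lra.
apply: le_trans (co_out_tail _ d0 i12 th1') _.
by rewrite ler_expR sqrrN mulrNN.
Qed.

Lemma uniform_pr_le1 (R : realType) (T : finType) (D : {set T}) (P : pred T) :
  uniform_pr R D P <= 1.
Proof.
rewrite /uniform_pr; have [->|D0] := eqVneq #|D| 0%N; first by rewrite invr0 mulr0.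
rewrite ler_pdivrMr ?ltr0n ?lt0n // mul1r ler_nat subset_leq_card //.
by apply/subsetP => x; rewrite inE => /andP[].
Qed.

Lemma codegrees_sparse (R : realType) (n d : nat) (eta : R) :
  (0 < d)%N -> (2 * d <= n)%N -> 0 <= eta ->
  digraph_pr R d (fun E : {set 'I_n * 'I_n} => ~~ good_codegrees d eta E)
  <= 2 * (n%:R ^+ 2 * expR (- (1 / 128 * eta * Num.min d%:R (eta * n%:R)))).
Proof.
move=> d0 dn eta0.
have d1 : 1 <= d%:R :> R by rewrite ler1n.
have dnR : 2 * d%:R <= n%:R :> R by rewrite -natrM ler_nat.
(* For smaller [eta] the exponential is at least 1/2, so the claimed bound is at least 1. Otherwise
   a union bound runs over the [n ^ 2] ordered pairs, the diagonal ones contributing 0. *)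
have [etan|etan] := leP 2 (eta * (n%:R - 1)); last first.
  apply: le_trans (uniform_pr_le1 _ _ _) _.
  have small : 1 / 128 * eta * Num.min d%:R (eta * n%:R) <= 1 / 2.
    apply: (@le_trans _ _ (1 / 128 * eta * d%:R)).
      have eta1 : 0 <= 1 / 128 * eta by rewrite mulr_ge0 // divr_ge0.
      by rewrite ler_wpM2l // ge_min lexx.
    have : eta * d%:R <= eta * (n%:R - 1) by rewrite ler_wpM2l //; lra.
    lra.
  have : 1 / 2 <= expR (- (1 / 128 * eta * Num.min d%:R (eta * n%:R))).
    by apply: le_trans (expR_ge1Dx _); lra.
  have : 1 <= n%:R ^+ 2 :> R by rewrite expr_ge1 //; lra.
  move: (expR _) (n%:R ^+ 2) => x y hy hx; nra.
apply: (@le_trans _ _ (digraph_pr R d (fun E => [exists ij : 'I_n * 'I_n,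
   (ij.1 != ij.2) && ~~ (`|(co_out E ij.1 ij.2)%:R - density R n d ^+ 2 * n%:R|
     <= eta * (density R n d * (1 - density R n d) * n%:R))]))).
  apply: uniform_pr_le => E _; rewrite negb_forall => /existsP[i].
  rewrite negb_forall => /existsP[j]; rewrite negb_imply => bad.
  by apply/existsP; exists (i, j).
apply: le_trans (uniform_pr_exists _ _ _) _.
apply: (@le_trans _ _ (\sum_(ij : 'I_n * 'I_n)
    2 * expR (- (1 / 128 * eta * Num.min d%:R (eta * n%:R))))).
  apply: ler_sum => -[i j] _ /=; case: (eqVneq i j) => [_|ij].
    rewrite /uniform_pr (_ : [set x in _ | _] = set0) ?cards0 ?mul0r ?mulr_ge0 ?expR_ge0 //.
    by apply/setP => x; rewrite !inE andbF.
  exact: co_out_deviation.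
rewrite sumr_const card_prod card_ord -[leLHS]mulr_natl natrM.
by rewrite le_eqVlt; apply/orP; left; apply/eqP; ring.
Qed.

(** * Complement graphs and codegree bounds for every degree *)

Lemma out_nbrs_setC (n : nat) (E : {set 'I_n * 'I_n}) i :
  out_nbrs (~: E) i = ~: out_nbrs E i.
Proof. by apply/setP => j; rewrite !inE. Qed.

Lemma in_nbrs_setC (n : nat) (E : {set 'I_n * 'I_n}) j :
  in_nbrs (~: E) j = ~: in_nbrs E j.
Proof. by apply/setP => i; rewrite !inE. Qed.

Lemma regular_digraphs_setC (n d : nat) (E : {set 'I_n * 'I_n}) :
  (d <= n)%N -> (~: E \in regular_digraphs n (n - d)) = (E \in regular_digraphs n d).
Proof.
move=> dn; have cE (U : {set 'I_n}) : (#|~: U| == n - d)%N = (#|U| == d).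
  have := cardsC U; rewrite card_ord => h.
  by apply/eqP/eqP; lia.
by rewrite !inE; apply: eq_forallb => i; rewrite out_nbrs_setC in_nbrs_setC !cE.
Qed.

(** Complementation adds [n - 2 * d] both to each codegree and to [p ^+ 2 * n], while [p * (1 - p)]
    is symmetric. *)
Lemma good_codegrees_setC (R : realType) (n d : nat) (eta : R)
    (E : {set 'I_n * 'I_n}) :
  (0 < n)%N -> (d <= n)%N -> E \in regular_digraphs n d ->
  good_codegrees (n - d) eta (~: E) = good_codegrees d eta E.
Proof.
move=> n0 dn ED; apply: eq_forallb => i; apply: eq_forallb => j; congr (_ ==> _).
have nR : n%:R != 0 :> R by rewrite pnatr_eq0 -lt0n.
have co : (co_out (~: E) i j + 2 * d = n + co_out E i j)%N.
  rewrite /co_out !out_nbrs_setC -setCU.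
  have := cardsC (out_nbrs E i :|: out_nbrs E j).
  have := cardsUI (out_nbrs E i) (out_nbrs E j).
  by rewrite card_ord !(regular_out_card _ ED); lia.
have pE : density R n (n - d) = 1 - density R n d.
  by rewrite /density natrB //; field.
rewrite pE; congr (`|_| <= _); last by ring.
move: co => /(congr1 (fun m => m%:R : R)); rewrite mul2n -addnn !natrD => co.
have -> : (co_out (~: E) i j)%:R = n%:R + (co_out E i j)%:R - 2 * d%:R :> R by lra.
by rewrite /density; field.
Qed.

Lemma digraph_pr_setC (R : realType) (n d : nat) (P : pred {set 'I_n * 'I_n}) :
  (d <= n)%N -> digraph_pr R d P = digraph_pr R (n - d) (fun E => P (~: E)).
Proof.
move=> dn; rewrite /digraph_pr.
have key E : (~: E \in regular_digraphs n d) = (E \in regular_digraphs n (n - d)).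
  by rewrite -(regular_digraphs_setC _ dn) setCK.
move: (regular_digraphs n d) (regular_digraphs n (n - d)) key => D D' key.
have card_setC_preim (U : {set {set 'I_n * 'I_n}}) : #|@setC _ @^-1: U| = #|U|.
  by rewrite on_card_preimset //; apply: onW_bij; exists (@setC _); exact: setCK.
rewrite /uniform_pr -card_setC_preim -[#|D|]card_setC_preim.
by congr (_%:R / _%:R); apply: eq_card => E; rewrite !inE key.
Qed.

Lemma regular_digraphs_gt0 (n d : nat) : (d <= n)%N -> (0 < #|regular_digraphs n d|)%N.
Proof.
case: n => [|n] dn.
  by apply/card_gt0P; exists set0; rewrite inE; apply/forallP => -[].
have cardlt : #|[set k : 'I_n.+1 | (k < d)%N]| = d.
  have inj : injective (widen_ord dn) by move=> x y /(congr1 val) /= /val_inj.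
  rewrite -[RHS]card_ord -[RHS]cardsT -[RHS](card_imset _ inj).
  apply: eq_card => k; rewrite !inE; apply/idP/imsetP => [kd|[x _ ->] /=];
    last exact: ltn_ord.
  by exists (Ordinal kd) => //; apply: val_inj.
have shift (i : 'I_n.+1) : #|[set j : 'I_n.+1 | ((i + j)%R < d)%N]| = d.
  rewrite -[RHS]cardlt -[RHS](card_preimset _ (addrI i)).
  by apply: eq_card => j; rewrite !inE.
(* Addition is modulo [n.+1]. Using the sum makes the graph symmetric, so one count serves both
   degrees. *)
apply/card_gt0P; exists [set e : 'I_n.+1 * 'I_n.+1 | ((e.1 + e.2)%R < d)%N].
rewrite inE; apply/forallP => i; apply/andP; split; apply/eqP.
  by rewrite -[RHS](shift i); apply: eq_card => j; rewrite !inE.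
by rewrite -[RHS](shift i); apply: eq_card => j; rewrite !inE (addrC i j).
Qed.

Lemma codegrees_bound (R : realType) (n d : nat) (eta : R) :
  (0 < d <= n)%N -> 0 <= eta ->
  digraph_pr R d (fun E : {set 'I_n * 'I_n} => ~~ good_codegrees d eta E)
  <= 2 * (n%:R ^+ 2 * (dhat n d)%:R ^+ 2 *
          expR (- (1 / 128 * eta * Num.min (dhat n d)%:R (eta * n%:R)))).
Proof.
move=> /andP[d0 dn] eta0; have n0 : (0 < n)%N by apply: leq_trans dn.
(* Now [dhat] is 0 and so is the bound, hence the bad event must be empty: in the complete graph
   every codegree equals [n], which is [p ^+ 2 * n]. *)
have [->|dltn] := eqVneq d n.
  rewrite /digraph_pr /uniform_pr (_ : [set x in _ | _] = set0).
    by rewrite cards0 mulr0n mul0r !mulr_ge0 ?expR_ge0 ?exprn_ge0 ?ler0n.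
  have nR : n%:R != 0 :> R by rewrite pnatr_eq0 -lt0n.
  apply/setP => E; rewrite inE [RHS]inE; apply/andP => -[ED /negP]; apply.
  apply/forallP => i; apply/forallP => j; apply/implyP => _.
  have full k : out_nbrs E k = setT.
    by apply/eqP; rewrite eqEcard subsetT cardsT card_ord (regular_out_card _ ED) /=.
  by rewrite /co_out !full setIT cardsT card_ord /density divff // expr1n mul1r
    !subrr normr0 mulr0 mul0r mulr0.
have weaken (m : nat) (x : R) : (0 < m)%N -> 0 <= x ->
    2 * (n%:R ^+ 2 * x) <= 2 * (n%:R ^+ 2 * m%:R ^+ 2 * x).
  move=> m0 x0; rewrite ler_wpM2l // ler_wpM2r // ler_peMr ?exprn_ge0 //.
  by rewrite expr_ge1 // ler1n.
have [dsmall|dbig] := leqP (2 * d) n.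
  have -> : dhat n d = d by rewrite /dhat; lia.
  by apply: le_trans (codegrees_sparse d0 dsmall eta0) _; rewrite weaken ?expR_ge0.
have -> : dhat n d = (n - d)%N by rewrite /dhat; lia.
have d'0 : (0 < n - d)%N by lia.
have d'small : (2 * (n - d) <= n)%N by lia.
apply: le_trans (le_trans (codegrees_sparse d'0 d'small eta0) _); last first.
  by rewrite weaken ?expR_ge0.
rewrite (digraph_pr_setC _ _ dn); apply: uniform_pr_le => E ED.
by have := good_codegrees_setC eta n0 (leq_subr _ _) ED; rewrite subKn // => ->.
Qed.

Lemma uniform_prC (R : realType) (T : finType) (D : {set T}) (P : pred T) :
  (0 < #|D|)%N -> uniform_pr R D P = 1 - uniform_pr R D (fun x => ~~ P x).
Proof.
move=> D0; apply/eqP; rewrite eq_sym subr_eq /uniform_pr -mulrDl -natrD; apply/eqP.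
have := cardsID [set x | P x] D; rewrite -setIdE => h.
have -> : [set x in D | ~~ P x] = D :\: [set x | P x].
  by apply/setP => x; rewrite !inE andbC.
by rewrite h divff // pnatr_eq0 -lt0n.
Qed.

(** The factor 128 cancels the constant of the exponent, and the summand 4 absorbs the prefactor,
    which is at most [n ^ 4] up to the constant 2. *)
Lemma codegrees_whp (R : realType) (K1 : R) (n d : nat) (eta : R) :
  0 < K1 -> (0 < d <= n)%N -> 0 <= eta ->
  128 * (K1 + 4) * Num.max (ln n%:R / (dhat n d)%:R) (Num.sqrt (ln n%:R / n%:R))
    <= eta ->
  1 - 2 * n%:R `^ (- K1)
  <= digraph_pr R d (fun E : {set 'I_n * 'I_n} => good_codegrees d eta E).
Proof.
move=> K10 hd eta0 etaK; have [d0 dn] := andP hd.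
have n0 : (0 < n)%N by apply: leq_trans dn.
have nR : 0 < n%:R :> R by rewrite ltr0n.
rewrite /digraph_pr uniform_prC ?regular_digraphs_gt0 // lerD2l lerN2.
apply: le_trans (codegrees_bound hd eta0) _; rewrite ler_wpM2l //.
have [->|dhat0] := eqVneq (dhat n d) 0%N.
  by rewrite expr0n /= mulr0 mul0r powR_ge0.
have hR : 0 < (dhat n d)%:R :> R by rewrite ltr0n lt0n.
set L := ln n%:R in etaK *; have L0 : 0 <= L by rewrite ln_ge0 // ler1n.
set K2 := 128 * (K1 + 4) in etaK *; have K20 : 1 <= K2 by rewrite /K2; lra.
have hmax (x : R) : x <= Num.max (L / (dhat n d)%:R) (Num.sqrt (L / n%:R)) ->
    K2 * x <= eta.
  by move=> hx; apply: le_trans etaK; rewrite ler_wpM2l //; lra.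
have h1 : K2 * L <= eta * (dhat n d)%:R.
  have := hmax (L / (dhat n d)%:R); rewrite le_max lexx => /(_ isT).
  by rewrite mulrA ler_pdivrMr.
(* Squaring the square-root condition yields [K2 ^+ 2 * L], which dominates [K2 * L] because
   [K2 >= 1]. *)
have h2 : K2 * L <= eta * (eta * n%:R).
  have := hmax (Num.sqrt (L / n%:R)); rewrite le_max lexx orbT => /(_ isT) h.
  have Ln : 0 <= L / n%:R by rewrite divr_ge0 // ltW.
  have s0 : 0 <= K2 * Num.sqrt (L / n%:R) by rewrite mulr_ge0 ?sqrtr_ge0 //; lra.
  have : (K2 * Num.sqrt (L / n%:R)) ^+ 2 <= eta ^+ 2 by rewrite ler_sqr ?nnegrE.
  rewrite exprMn sqr_sqrtr // => h3; rewrite mulrA ler_pdivrMr // in h3.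
  apply: (@le_trans _ _ (K2 ^+ 2 * L)); last by rewrite mulrA -expr2.
  by rewrite ler_wpM2r // expr2 ler_peMr //; lra.
have h3 : K2 * L <= eta * Num.min (dhat n d)%:R (eta * n%:R) by rewrite minEle; case: ifP.
have nE : n%:R = expR L :> R by rewrite lnK.
have dhatn : (dhat n d)%:R ^+ 2 <= n%:R ^+ 2 :> R.
  by rewrite ler_sqr ?nnegrE ?ler0n // ler_nat /dhat; lia.
apply: (@le_trans _ _ (n%:R ^+ 2 * n%:R ^+ 2 * expR (- ((K1 + 4) * L)))).
  apply: ler_pM; rewrite ?mulr_ge0 ?exprn_ge0 ?expR_ge0 //.
    by rewrite ler_wpM2l // exprn_ge0.
  by rewrite ler_expR lerN2; rewrite /K2 in h3; lra.
rewrite /powR gt_eqF // -/L -exprD nE -expRM_natl -expRD ler_expR; lra.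
Qed.

(** * Explicit tails for edge counts and the final estimates *)

Lemma muhat_ge0 (R : realType) (n d : nat) (A B : {set 'I_n}) : 0 <= muhat R d A B.
Proof. by rewrite /muhat /density mulr_ge0 // divr_ge0. Qed.

(** The choice [theta = tau / (4 + tau)] stays below 1 and behaves like the unconstrained minimiser
    [tau / 4] for small [tau]. *)
Lemma edge_count_upper_tail (R : realType) (n d : nat) (A B : {set 'I_n}) (tau : R) :
  (0 < n)%N -> 0 <= tau ->
  digraph_pr R d (fun E => tau * muhat R d A B <= (edge_count E A B)%:R - mu R d A B)
  <= expR (- (tau ^+ 2 * muhat R d A B / (8 + 2 * tau))).
Proof.
move=> n0 tau0; have m0 := muhat_ge0 R d A B.
have t4 : 0 < 4 + tau by lra.
have th1 : tau / (4 + tau) <= 1 by rewrite ler_pdivrMr //; lra.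
have th0 : 0 <= tau / (4 + tau) by rewrite divr_ge0 // ltW.
apply: (@le_trans _ _ (digraph_pr R d (fun E => tau / (4 + tau) * (tau * muhat R d A B)
    <= tau / (4 + tau) * ((edge_count E A B)%:R - mu R d A B)))).
  by apply: uniform_pr_le => E _ h; rewrite ler_wpM2l.
apply: le_trans (edge_count_tail _ _ _ _ n0 th1) _; rewrite ler_expR -subr_ge0.
move: (muhat R d A B) m0 => m m0.
rewrite [leRHS](_ : _ = m * tau ^+ 3 / (2 * (4 + tau) ^+ 2)).
  by rewrite divr_ge0 ?mulr_ge0 ?exprn_ge0 ?(ltW t4).
by field; rewrite !gt_eqF //; lra.
Qed.

(** A negative [theta] always satisfies [theta <= 1], so the exact minimiser [- (tau / 4)] is
    available. *)
Lemma edge_count_lower_tail (R : realType) (n d : nat) (A B : {set 'I_n}) (tau : R) :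
  (0 < n)%N -> 0 <= tau ->
  digraph_pr R d (fun E =>
    (edge_count E A B)%:R - mu R d A B <= - (tau * muhat R d A B))
  <= expR (- (tau ^+ 2 * muhat R d A B / 8)).
Proof.
move=> n0 tau0; have th1 : - (tau / 4) <= 1 by lra.
apply: (@le_trans _ _ (digraph_pr R d (fun E => - (tau / 4) * - (tau * muhat R d A B)
    <= - (tau / 4) * ((edge_count E A B)%:R - mu R d A B)))).
  by apply: uniform_pr_le => E _ h; rewrite ler_wnM2l //; lra.
by apply: le_trans (edge_count_tail _ _ _ _ n0 th1) _; rewrite ler_expR; lra.
Qed.

Theorem theorem1p3 (R : realType) :
  exists c C1 C2 : R, [/\ 0 < c, 0 < C1 & 0 < C2] /\
  [/\ (exists2 C : R, 0 < C &
        forall (n d : nat) (eta : R), (0 < d <= n)%N -> 0 <= eta ->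
          digraph_pr R d (fun E : {set 'I_n * 'I_n} => ~~ good_codegrees d eta E)
          <= C * (n%:R ^+ 2 * (dhat n d)%:R ^+ 2 *
                  expR (- (c * eta * Num.min (dhat n d)%:R (eta * n%:R))))),
      (exists2 C : R, 0 < C &
        forall K1 : R, 0 < K1 -> exists2 K2 : R, 0 < K2 &
        forall (n d : nat) (eta : R), (0 < d <= n)%N -> 0 <= eta ->
          K2 * Num.max (ln n%:R / (dhat n d)%:R) (Num.sqrt (ln n%:R / n%:R)) <= eta ->
          1 - C * n%:R `^ (- K1)
          <= digraph_pr R d (fun E : {set 'I_n * 'I_n} => good_codegrees d eta E)),
      (forall (n d : nat) (eta tau : R) (A B : {set 'I_n}),
        (0 < d <= n)%N -> 0 <= eta -> 0 <= tau ->
        eta <= Num.min (1 / 4) (tau / 8) ->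
        digraph_pr R d (fun E : {set 'I_n * 'I_n} =>
          (tau * muhat R d A B <= (edge_count E A B)%:R - mu R d A B)
          && good_codegrees d eta E)
        <= expR (- (tau ^+ 2 * muhat R d A B / (C1 + C2 * tau)))),
      (forall (n d : nat) (eta tau : R) (A B : {set 'I_n}),
        (0 < d <= n)%N -> 0 <= eta -> 0 <= tau ->
        eta <= tau / 4 ->
        digraph_pr R d (fun E : {set 'I_n * 'I_n} =>
          ((edge_count E A B)%:R - mu R d A B <= - (tau * muhat R d A B))
          && good_codegrees d eta E)
        <= expR (- (tau ^+ 2 * muhat R d A B / C1))) &
      (forall (n d : nat) (eta tau : R) (A B : {set 'I_n}),
        (0 < d <= n)%N -> 0 <= eta -> 0 <= tau ->
        eta <= Num.min (1 / 4) (tau / 8) ->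
        digraph_pr R d (fun E : {set 'I_n * 'I_n} =>
          (tau * muhat R d A B <= disc R d E A B) && good_codegrees d eta E)
        <= 2 * expR (- (tau ^+ 2 / (C1 + C2 * tau) * muhat R d A B)))].
Proof.
(* The value [1 / 128] comes from [chernoff_parameter]; 8 and 2 come from the denominator in
   [edge_count_upper_tail]. *)
exists (1 / 128), 8, 2; split; first by split; rewrite ?divr_gt0.
have upper (n d : nat) (eta tau : R) (A B : {set 'I_n}) : (0 < d <= n)%N -> 0 <= tau ->
    digraph_pr R d (fun E => (tau * muhat R d A B <= (edge_count E A B)%:R - mu R d A B)
      && good_codegrees d eta E)
    <= expR (- (tau ^+ 2 * muhat R d A B / (8 + 2 * tau))).
  move=> /andP[d0 dn] tau0; have n0 := leq_trans d0 dn.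
  apply: le_trans (edge_count_upper_tail d A B n0 tau0).
  by apply: uniform_pr_le => E _ /andP[].
have lower (n d : nat) (eta tau : R) (A B : {set 'I_n}) : (0 < d <= n)%N -> 0 <= tau ->
    digraph_pr R d (fun E => ((edge_count E A B)%:R - mu R d A B <= - (tau * muhat R d A B))
      && good_codegrees d eta E)
    <= expR (- (tau ^+ 2 * muhat R d A B / 8)).
  move=> /andP[d0 dn] tau0; have n0 := leq_trans d0 dn.
  apply: le_trans (edge_count_lower_tail d A B n0 tau0).
  by apply: uniform_pr_le => E _ /andP[].
split.
- by exists 2 => // n d eta hd eta0; exact: codegrees_bound.
- exists 2 => // K1 K10; exists (128 * (K1 + 4)); first by lra.
  by move=> n d eta hd eta0; exact: codegrees_whp.
- by move=> n d eta tau A B hd _ tau0 _; exact: upper.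
- by move=> n d eta tau A B hd _ tau0 _; exact: lower.
move=> n d eta tau A B hd _ tau0 _; have m0 := muhat_ge0 R d A B.
apply: (@le_trans _ _ (digraph_pr R d (fun E : {set 'I_n * 'I_n} =>
    ((tau * muhat R d A B <= (edge_count E A B)%:R - mu R d A B)
       && good_codegrees d eta E) ||
    (((edge_count E A B)%:R - mu R d A B <= - (tau * muhat R d A B))
       && good_codegrees d eta E)))).
  apply: uniform_pr_le => E _ /andP[]; rewrite /disc ler_normr => /orP[hE|hE] ->.
    by rewrite hE.
  by rewrite !andbT lerNr hE orbT.
apply: le_trans (uniform_prU _ _ _ _) _; rewrite mulr_natl mulr2n mulrAC lerD //.
  exact: upper.
(* The lower tail has denominator 8, at most [8 + 2 * tau], so both tails obey the weaker common
   bound. *)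
apply: le_trans (lower _ _ _ _ _ _ hd tau0) _; rewrite ler_expR lerN2.
have c0 : 0 <= tau ^+ 2 * muhat R d A B by apply: mulr_ge0; first exact: sqr_ge0.
by apply: ler_wpM2l => //; rewrite lef_pV2 ?posrE; lra.
Qed.
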